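(* A semi-normalized frame $(x_i,f_i)_{i\in\mathbb{N}}$ of an infinite dimensional Hilbert space $H$ cannot have the NQP with respect to the associated Hilbert space $\ell_2(\mathbb{N})$ (with its unit vector basis).
   Context: All spaces are real. A sequence $(x_i,f_i)_{i\in\mathbb{N}}$, $x_i\in H$, $f_i\in H^*$, is a (Schauder) frame of $H$ if $x=\sum_{i=1}^\infty f_i(x)x_i$ in norm for every $x\in H$; it is semi-normalized if $0<\inf_i\|x_i\|\le\sup_i\|x_i\|<\infty$ and $0<\inf_i\|f_i\|\le\sup_i\|f_i\|<\infty$. The space $\ell_2(\mathbb{N})$ with unit vector basis $(e_i)$ is associated to the frame if $S:\ell_2\to H$, $\sum a_ie_i\mapsto\sum a_ix_i$, and $T:H\to\ell_2$, $x\mapsto\sum_{x_i\neq 0} f_i(x)e_i$, are well-defined bounded operators. The frame has the NQP with respect to $\ell_2(\mathbb{N})$ if $\ell_2(\mathbb{N})$ is associated to it and there are $\varepsilon,\delta>0$ and $C\ge1$ such that for all $x\in H$ there is a finitely supported $(k_i)\subset\mathbb{Z}$ with $\|\sum k_i\delta e_i\|_{\ell_2}\le C\|x\|$ and $\|x-\sum\delta k_ix_i\|_H\le\varepsilon$. *)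

(* Defs.v *)
From HB Require Import structures.
From mathcomp Require Import all_boot all_order all_algebra.
From mathcomp Require Import finmap.
From mathcomp Require Import all_classical all_reals all_analysis.
Import Order.TTheory GRing.Theory Num.Theory.
Import numFieldNormedType.Exports.

Set Implicit Arguments.
Unset Strict Implicit.
Unset Printing Implicit Defensive.

Local Open Scope classical_set_scope.
Local Open Scope ring_scope.

(* For the counting measure on nat, LfunType needs no quotient by almost
   everywhere equality: its elements are the square-summable real sequences. *)
Definition ell2 (R : realType) :=
  LfunType (@counting nat R : {measure set nat -> \bar R}) (lee1n 2).

Section Ell2.
Variable R : realType.

HB.instance Definition _ := GRing.Lmodule.on (ell2 R).

Definition ell2_norm (a : ell2 R) : R :=
  fine ('N[@counting nat R]_2%:R%:E[EFin \o a])%E.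

Lemma ell2_normD (a b : ell2 R) :
  ell2_norm (a + b) <= ell2_norm a + ell2_norm b.
Proof. exact: ler_LnormD. Qed.

Lemma ell2_normZ (l : R) (a : ell2 R) : ell2_norm (l *: a) = `|l| * ell2_norm a.
Proof.
by rewrite /ell2_norm; have := LnormZ a l => /= ->; rewrite -finite_norm_fine.
Qed.

Lemma ell2_norm0_eq0 (a : ell2 R) : ell2_norm a = 0 -> a = 0.
Proof.
move=> /fine_Lnormr_eq0[A [_ A0 aA]]; apply/LfuneqP => i.
apply: contrapT => ai; have Ai : A i by apply: aA => /(_ I).
move: A0; rewrite /= /counting.
have [fA|nfA] := pselect (finite_set A); last by rewrite asboolF.
rewrite asboolT// => /eqP; rewrite eqe.
rewrite pnatr_eq0 cardfs_eq0 => /eqP A0.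
by move: Ai; rewrite -(fset_setK fA) A0.
Qed.

HB.instance Definition _ := Lmodule_isNormed.Build R (ell2 R)
  ell2_normD ell2_normZ ell2_norm0_eq0.

Lemma ell2_unit_subproof (i : nat) :
  (fun j => (j == i)%:R : R) \in Lfun (@counting nat R) 2%:R%:E.
Proof.
rewrite inE/=; apply/andP; split; rewrite inE//=.
rewrite /finite_norm Lnorm_counting//.
rewrite (nneseriesD1 (n := i))//; last by move=> k _; exact: poweR_ge0.
rewrite eseries0 ?adde0; last first.
  by move=> k _ /andP[_ /negbTE ki]; rewrite /= ki normr0 powR0.
by rewrite /= eqxx normr1 powR1 powR1 ltry.
Qed.

Definition ell2_unit (i : nat) : ell2 R :=
  Lfun_Sub (lee1n 2) (ell2_unit_subproof i).

End Ell2.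

Section Frames.
Variables (R : realType) (H : completeNormedModType R).

Definition infinite_dimensional :=
  ~ exists (n : nat) (b : 'I_n -> H),
      forall h : H, exists a : 'I_n -> R, h = \sum_(i < n) a i *: b i.

(* Norm of H^*, in \bar R so that it is the true supremum for every linear f. *)
Definition dual_norm (f : {linear H -> R^o}) : \bar R :=
  ereal_sup [set `|f h|%:E | h in [set h : H | `|h| <= 1]].

Definition bounded_operator (U V : normedModType R) (L : {linear U -> V}) :=
  exists M : R, forall u : U, `|L u| <= M * `|u|.

Implicit Types (x : nat -> H) (f : nat -> {linear H -> R^o}).

Definition frame x f :=
  (forall i, continuous (f i)) /\
  forall h : H, series (fun i => f i h *: x i) @ \oo --> h.

Definition semi_normalized x f :=
  [/\ (0 < ereal_inf (range (fun i => `|x i|%:E)))%E,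
      (ereal_sup (range (fun i => `|x i|%:E)) < +oo)%E,
      (0 < ereal_inf (range (fun i => dual_norm (f i))))%E &
      (ereal_sup (range (fun i => dual_norm (f i))) < +oo)%E].

Definition ell2_associated x f :=
  (exists S : {linear ell2 R -> H}, bounded_operator S /\
     forall a : ell2 R, series (fun i => a i *: x i) @ \oo --> S a) /\
  (exists T : {linear H -> ell2 R}, bounded_operator T /\
     forall h : H,
       (fun n => \sum_(0 <= i < n | x i != 0) (f i h : R) *: ell2_unit R i)
         @ \oo --> T h).

Definition ell2_NQP x f :=
  ell2_associated x f /\
  exists eps delta C : R, [/\ 0 < eps, 0 < delta, 1 <= C &
    forall h : H, exists k : {fsfun nat -> int with 0},
      `| \sum_(i <- finsupp k) (delta * (k i)%:~R) *: ell2_unit R i | <= C * `|h|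
      /\ `| h - \sum_(i <- finsupp k) (delta * (k i)%:~R) *: x i | <= eps].

End Frames.

(* Main.v *)
(* Boundedness of the synthesis operator makes (x_i) a Bessel sequence, so
   <h, x_i> -> 0 for each h.  A quantization y = delta * sum k_i x_i of h with
   |h| = 2 eps satisfies <h, y> >= |h|^2 / 2, while k_i integral gives
   sum |k_i| <= sum k_i^2 <= (C |h| / delta)^2.  Hence the NQP yields a c > 0
   with c |h| <= sup_i |<h, x_i>| for all h.  In infinite dimension this is
   impossible: adding m orthonormal vectors with nearly disjoint coefficient
   sequences gives norm sqrt m but uniformly bounded coefficients. *)
Require Import Defs.
From mathcomp Require Import all_boot all_order all_algebra.
From mathcomp Require Import sesquilinear finmap ring lra.
From mathcomp Require Import all_classical all_reals all_analysis.
Import Order.TTheory GRing.Theory Num.Theory.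
Import numFieldNormedType.Exports.
Set Implicit Arguments.
Unset Strict Implicit.
Unset Printing Implicit Defensive.

Local Open Scope ring_scope.

Section FiniteSums.
Variables (R : realType) (s : seq nat) (c : nat -> R).
Hypothesis uniq_s : uniq s.

Lemma ell2_sum_unitE (j : nat) :
  (\sum_(i <- s) c i *: ell2_unit R i) j = if j \in s then c j else 0.
Proof.
have -> : forall t : seq nat, (\sum_(i <- t) c i *: ell2_unit R i) j =
    \sum_(i <- t) c i * (j == i)%:R.
  elim=> [|i t IH]; first by rewrite !big_nil.
  by rewrite !big_cons -IH.
case: ifPn => js.
  rewrite (bigD1_seq j)//= eqxx mulr1 big1_seq ?addr0// => i /andP[].
  by rewrite eq_sym => /negPf -> _; rewrite mulr0.
rewrite big1_seq// => i /andP[_ si]; have [ji|_] := eqVneq j i.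
  by rewrite ji si in js.
by rewrite mulr0.
Qed.

Lemma sqr_ell2_norm_sum_unit :
  `|\sum_(i <- s) c i *: ell2_unit R i| ^+ 2 = \sum_(i <- s) c i ^+ 2.
Proof.
set a := (X in `|X|).
(* [n] exceeds every index in [s], so the norm series has no terms from [n] on. *)
pose n := (\max_(i <- s) i).+1.
have ltn i : i \in s -> (i < n)%N by move=> si; rewrite ltnS leq_bigmax_seq.
have -> : `|a| = ell2_norm a by [].
rewrite /ell2_norm Lnorm_counting//.
rewrite (nneseries_split 0 n); last by move=> k _; exact: poweR_ge0.
rewrite eseries0 ?adde0; last first.
  move=> k nk _ /=; rewrite ell2_sum_unitE ifN ?normr0 ?powR0//.
  by apply/negP => /ltn; rewrite ltnNge nk.
rewrite add0n.
have -> : (\sum_(0 <= k < n) `|(EFin \o a) k| `^ 2 = (\sum_(i <- s) c i ^+ 2)%:E)%E.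
  have pe : perm_eq [seq k <- index_iota 0 n | k \in s] s.
    apply: uniq_perm; rewrite ?filter_uniq ?iota_uniq// => k.
    by rewrite mem_filter mem_index_iota; case: (boolP (k \in s)) => // /ltn ->.
  rewrite -(perm_big _ pe) big_filter [in RHS]big_mkcond/= -sumEFin.
  apply: eq_bigr => k _ /=.
  rewrite powR_mulrn// ell2_sum_unitE.
  by case: ifP => _; rewrite ?real_normK ?num_real// ?normr0 ?expr0n.
rewrite poweR_EFin/= powR12_sqrt ?sqr_sqrtr//.
  by apply: sumr_ge0 => i _; exact: sqr_ge0.
by apply: sumr_ge0 => i _; exact: sqr_ge0.
Qed.
End FiniteSums.

Section Orthogonality.
Variables (R : realType) (H : completeNormedModType R)
  (dot : {dot H for idfun}).
Hypothesis dot_norm : forall h : H, dot h h = `|h| ^+ 2.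

Lemma dotC u v : dot u v = dot v u.
Proof. by rewrite hermC /= expr0 mul1r. Qed.

Lemma dotDZl a u v w : dot (u + a *: v) w = dot u w + a * dot v w.
Proof. by rewrite linearDl linearZl_LR. Qed.

Lemma dot_le_norm u v : `|dot u v| <= `|u| * `|v|.
Proof.
have [->|v0] := eqVneq v 0; first by rewrite linear0r !normr0 mulr0.
have v2 : 0 < `|v| ^+ 2 by rewrite exprn_gt0// normr_gt0.
rewrite -ler_sqr ?nnegrE ?mulr_ge0// exprMn real_normK ?num_real//.
(* Cauchy-Schwarz: this squared norm expands to |v|^2 (|u|^2 |v|^2 - <u,v>^2). *)
have := sqr_ge0 (Num.norm (`|v| ^+ 2 *: u + (- dot u v) *: v)).
rewrite -dot_norm (linearDr dot) !(linearZr_LR dot) !(linearDl dot).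
rewrite !(linearZl_LR dot)/=.
rewrite (dotC v u) !dot_norm => uv_ge0.
rewrite -subr_ge0 -(pmulr_rge0 _ v2); apply: (le_trans uv_ge0).
by rewrite le_eqVlt; apply/orP; left; apply/eqP; ring.
Qed.

(** Induction on [s]: each new [v] costs at most one extra direction [w], orthogonal to the earlier
    vectors but not to [v]. If there is no such [w], orthogonality to [v] is automatic. *)
Lemma ortho_complement_finite_codim (s : seq H) :
  exists (n : nat) (b : 'I_n -> H), forall h : H, exists a : 'I_n -> R,
    forall v, v \in s -> dot (h - \sum_(i < n) a i *: b i) v = 0.
Proof.
elim: s => [|v s [n [b IH]]].
  by exists 0%N, (fun=> 0) => h; exists (fun=> 0).
have [[w [ws wv]]|nw] := pselect (exists w, (forall u, u \in s -> dot w u = 0)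
    /\ dot w v != 0); last first.
  exists n, b => h; have [a ha] := IH h; exists a => u.
  rewrite inE => /predU1P[->|]; last exact: ha.
  by apply: contra_notP nw => /eqP nz; eexists; split; [exact: ha|exact: nz].
exists n.+1, (fun i => oapp b w (unlift ord0 i)) => h.
have [a ha] := IH h.
set g := h - \sum_(i < n) a i *: b i in ha.
(* Index 0 carries [w], with the coefficient that cancels the pairing of [g] with [v]. *)
exists (fun i => oapp a (dot g v / dot w v) (unlift ord0 i)) => u us.
rewrite big_ord_recl unlift_none /=.
under eq_bigr do rewrite liftK /=.
rewrite opprD addrCA addrC -/g -scaleNr dotDZl mulNr.
move: us; rewrite inE => /predU1P[->|us]; first by rewrite divfK ?subrr.
by rewrite (ha _ us) (ws _ us) mulr0 subr0.
Qed.

Lemma exists_unit_orthogonal (s : seq H) : infinite_dimensional H ->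
  exists2 g : H, `|g| = 1 & forall v, v \in s -> dot g v = 0.
Proof.
move=> Hinf; have [n [b hb]] := ortho_complement_finite_codim s.
have [h hN] : exists h, forall a : 'I_n -> R, h != \sum_(i < n) a i *: b i.
  apply: contra_notP Hinf => /forallNP nh; exists n, b => h.
  have /existsNP[a /negP/negPn/eqP ha] := nh h; by exists a.
have [a ha] := hb h; have := hN a; rewrite -subr_eq0.
set g := h - _ => g0; exists (`|g|^-1 *: g).
  by rewrite normrZ normfV normr_id mulVf// normr_eq0.
by move=> v vs; rewrite -[_ *: g]add0r dotDZl linear0l ha// mulr0 addr0.
Qed.

Section Bessel.
Variables (x : nat -> H) (M : R).
Hypothesis bessel : forall h n, \sum_(0 <= i < n) dot h (x i) ^+ 2 <= M ^+ 2 * `|h| ^+ 2.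

Lemma bessel_dot_le (h : H) i : `|dot h (x i)| <= `|M| * `|h|.
Proof.
rewrite -ler_sqr ?nnegrE ?mulr_ge0// exprMn !real_normK ?num_real//.
apply: le_trans (bessel h i.+1); rewrite big_nat_recr//= lerDr.
by apply: sumr_ge0 => j _; exact: sqr_ge0.
Qed.

Lemma bessel_dot_small (h : H) : exists N, forall i, (N <= i)%N -> `|dot h (x i)| <= 1.
Proof.
have : cvgn (series (fun i => dot h (x i) ^+ 2)).
  apply: nondecreasing_is_cvgn.
    by apply: nondecreasing_series => i _ _; exact: sqr_ge0.
  by exists (M ^+ 2 * `|h| ^+ 2) => _ [n _ <-]; exact: bessel.
move=> /cvg_series_cvg_0/cvgrPdist_le/(_ 1 ltr01)[N _ hN]; exists N => i Ni.
have := hN i Ni; rewrite /= sub0r normrN normrX => ?.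
by rewrite -(@expr_le1 _ 2).
Qed.

(* Gliding hump: each new unit vector is orthogonal to the coordinates where
   the previous sum is not yet small, so every coordinate sees one large term. *)
Lemma exists_flat_vector (m : nat) : infinite_dimensional H ->
  exists h : H, `|h| ^+ 2 = m%:R /\ forall i, `|dot h (x i)| <= `|M| + 1.
Proof.
move=> Hinf; elim: m => [|m [h [hm hx]]].
  by exists 0; rewrite normr0 expr0n; split=> // i; rewrite linear0l normr0 addr_ge0.
have [N hN] := bessel_dot_small h.
(* Including [h] itself in the list lets Pythagoras raise the squared norm by exactly 1. *)
have [g g1 gs] := exists_unit_orthogonal (h :: [seq x i | i <- iota 0 N]) Hinf.
have gh : dot g h = 0 by apply: gs; rewrite mem_head.
exists (h + 1 *: g); split.
  rewrite -dot_norm dotDZl mul1r !(dotC _ (_ + _)) !dotDZl !mul1r (dotC h g) gh.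
  by rewrite !dot_norm hm g1 addr0 add0r expr1n -natr1.
move=> i; rewrite dotDZl mul1r; have [Ni|iN] := leqP N i.
  rewrite addrC; apply: le_trans (ler_normD _ _) _; rewrite lerD ?hN//.
  by rewrite -[leRHS]mulr1 -g1 bessel_dot_le.
by rewrite (gs (x i)) ?addr0// inE map_f ?orbT// mem_iota.
Qed.

End Bessel.
End Orthogonality.

Section Synthesis.
Variables (R : realType) (H : completeNormedModType R)
  (dot : {dot H for idfun}).
Hypothesis dot_norm : forall h : H, dot h h = `|h| ^+ 2.
Variables (x : nat -> H) (S : {linear ell2 R -> H}).
Hypothesis Sx : forall a : ell2 R, (series (fun i => a i *: x i) @ \oo --> S a)%classic.

Lemma synthesis_unit j : S (ell2_unit R j) = x j.
Proof.
apply: (cvg_unique _ (@Sx (ell2_unit R j))) => //.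
apply: cvg_near_cst.
exists j.+1 => // n /= jn; rewrite /series /=.
rewrite (bigD1_seq j)/= ?mem_index_iota ?iota_uniq// eqxx scale1r.
by rewrite big1 ?addr0// => i /negPf ->; rewrite scale0r.
Qed.

(** Duality: for the truncated coefficient sequence [a] of [h], |a|^2 = <h, S a> <= M |h| |a|, and
    one factor |a| cancels. *)
Lemma synthesis_bessel M h n : (forall a, `|S a| <= M * `|a|) ->
  \sum_(0 <= i < n) dot h (x i) ^+ 2 <= M ^+ 2 * `|h| ^+ 2.
Proof.
move=> SM; pose a := \sum_(i <- index_iota 0 n) dot h (x i) *: ell2_unit R i.
have aE : `|a| ^+ 2 = \sum_(0 <= i < n) dot h (x i) ^+ 2.
  by rewrite sqr_ell2_norm_sum_unit// iota_uniq.
have : `|a| ^+ 2 <= `|h| * (M * `|a|).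
  apply: (le_trans _ (ler_wpM2l (normr_ge0 h) (SM a))).
  suff -> : `|a| ^+ 2 = dot h (S a).
    exact: le_trans (ler_norm _) (dot_le_norm dot_norm _ _).
  rewrite aE /a !linear_sum/=.
  by apply: eq_bigr => i _; rewrite linearZ/= synthesis_unit (linearZr_LR dot).
rewrite -aE; have [->|a0] := eqVneq `|a| 0.
  by rewrite expr0n => _; rewrite mulr_ge0 ?sqr_ge0.
have a_gt0 : 0 < `|a| by rewrite lt_def a0 normr_ge0.
rewrite [X in X <= _ -> _]expr2 mulrA ler_pM2r// mulrC => aM.
(* The sign of [M] is not given; squaring needs only that this product is nonnegative. *)
have Mh_ge0 : 0 <= M * `|h| by apply: le_trans aM; exact: normr_ge0.
by rewrite -exprMn lerXn2r// nnegrE normr_ge0.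
Qed.

End Synthesis.

(** Integrality enters here: a nonzero integer has absolute value at least 1. This turns the l2
    bound of the NQP into an l1 bound. *)
Lemma sum_norm_int_le_sqr (R : realDomainType) (s : seq nat) (k : nat -> int) :
  \sum_(i <- s) `|(k i)%:~R : R| <= \sum_(i <- s) (k i)%:~R ^+ 2.
Proof.
apply: ler_sum => i _; rewrite -[leRHS]real_normK ?num_real// -intr_norm -abszE.
by rewrite -pmulrn -natrX ler_nat; case: absz => // n; rewrite leq_pmulr.
Qed.

Lemma dot_sum_le (R : realType) (H : completeNormedModType R)
  (dot : {dot H for idfun}) (x : nat -> H) (h : H) (s : seq nat) (c : nat -> R) (B : R) :
  (forall i, `|dot h (x i)| <= B) ->
  dot h (\sum_(i <- s) c i *: x i) <= B * \sum_(i <- s) `|c i|.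
Proof.
move=> hB; rewrite linear_sum/= mulr_sumr; apply: ler_sum => i _.
rewrite (linearZr_LR dot)/= (le_trans (ler_norm _))// normrM mulrC.
by rewrite ler_wpM2r.
Qed.

Theorem corollary4p8 (R : realType) (H : completeNormedModType R)
  (dot : {dot H for idfun}) (dot_norm : forall h : H, dot h h = `|h| ^+ 2)
  (H_infinite : infinite_dimensional H)
  (x : nat -> H) (f : nat -> {linear H -> R^o}) :
  frame x f -> semi_normalized x f -> ~ ell2_NQP x f.
Proof.
move=> _ _ [[[S [[M SM] Sx]] _] [eps [delta [C [eps0 delta0 C1 nqp]]]]].
have bessel h n := synthesis_bessel dot_norm Sx h n SM.
set B := `|M| + 1.
have B0 : 0 < B by rewrite ltr_wpDl.
(* [D] is chosen so that the pairing of [t *: h] with its quantization is at most 2 eps^2 D /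
   (m+1). *)
pose D := 4 * C ^+ 2 * eps * B / delta.
have [m Dm] : exists m : nat, D < m.+1%:R.
  exists (Num.truncn D); exact: truncnS_gt.
(* A perfect square number of vectors makes |h| equal to m+1, with no square root. *)
have [h [hm hB]] := exists_flat_vector dot_norm bessel (m.+1 ^ 2)%N H_infinite.
have m0 : 0 < m.+1%:R :> R by [].
(* Rescaling to norm 2 eps shrinks the coefficients to at most 2 eps B / (m+1). *)
pose t : R := 2 * eps / m.+1%:R.
have t0 : 0 < t by rewrite divr_gt0// mulr_gt0.
have hE : `|h| = m.+1%:R.
  by apply/eqP; rewrite -(@eqrXn2 _ 2)// hm natrX.
have thE : `|t *: h| = 2 * eps by rewrite normrZ hE gtr0_norm// divfK// gt_eqF.
have [k []] := nqp (t *: h); rewrite thE => kC.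
set y := (X in t *: h - X) => hy.
have thB i : `|dot (t *: h) (x i)| <= t * B.
  by rewrite (linearZl_LR dot)/= normrM gtr0_norm// ler_pM2l.
have ksum : delta * \sum_(i <- finsupp k) `|delta * (k i)%:~R| <= (C * (2 * eps)) ^+ 2.
  have : `|\sum_(i <- finsupp k) (delta * (k i)%:~R) *: ell2_unit R i| ^+ 2
      <= (C * (2 * eps)) ^+ 2 by rewrite lerXn2r// nnegrE// (le_trans _ kC).
  rewrite (sqr_ell2_norm_sum_unit (fun i => delta * (k i)%:~R)) ?fset_uniq//.
  apply: le_trans.
  under eq_bigr do rewrite normrM gtr0_norm//.
  under [leRHS]eq_bigr do rewrite exprMn.
  rewrite -!mulr_sumr mulrA -expr2 ler_pM2l ?exprn_gt0//.
  exact: sum_norm_int_le_sqr.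
have dot_y : dot (t *: h) y <= t * B * ((C * (2 * eps)) ^+ 2 / delta).
  apply: (le_trans (@dot_sum_le _ _ _ _ _ _ _ _ thB)).
  by rewrite ler_pM2l ?mulr_gt0// ler_pdivlMr// mulrC.
have dot_hy : dot (t *: h) (t *: h - y) <= 2 * eps * eps.
  apply: le_trans (ler_norm _) _; apply: le_trans (dot_le_norm dot_norm _ _) _.
  by rewrite thE ler_pM2l ?mulr_gt0.
(* Splitting the second argument as (t h - y) + y gives 4 eps^2 <= 2 eps^2 + 2 eps^2 D / (m+1),
   which contradicts D < m+1. *)
have : (2 * eps) ^+ 2 <= 2 * eps * eps + t * B * ((C * (2 * eps)) ^+ 2 / delta).
  by rewrite -[in leLHS]thE -dot_norm -[X in dot _ X](subrK y) linearDr lerD.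
have -> : t * B * ((C * (2 * eps)) ^+ 2 / delta) = 2 * eps ^+ 2 * (D / m.+1%:R).
  by rewrite /t /D; field; rewrite !gt_eqF.
have Dm1 : D / m.+1%:R < 1 by rewrite ltr_pdivrMr// mul1r.
have : eps ^+ 2 * (D / m.+1%:R) < eps ^+ 2 by rewrite gtr_pMr// exprn_gt0.
by move: (D / _) => d; lra.
Qed.
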